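(* Let $(a_n)_{n\ge1}$ be a complex sequence with $a_1\ne0$ and $\sum_n|a_n|n^{\epsilon}<\infty$ for some $\epsilon>0$, and suppose its convolution inverse $(b_n)$ satisfies $\sum_n|b_n|/\sqrt n<\infty$. Then the operator $\mathcal F(a_n)=T(\overline{b_n})ST(a_n)$ is a unitary operator on $L^2[0,\infty)$.
   Context: For a complex sequence $(a_n)_{n\ge1}$, $T(a_n)f(x)=\sum_{n=1}^\infty a_nf(nx)$ ($x>0$); when $\sum|a_n|/\sqrt n<\infty$ this extends to a bounded operator on $L^2[0,\infty)$. The Dirichlet convolution is $(a\ast b)_k=\sum_{mn=k}a_mb_n$; the convolution inverse of $(a_n)$ (with $a_1\ne0$) is the unique $(b_n)$ with $a\ast b=\delta$, where $\delta_1=1$, $\delta_n=0$ for $n>1$. $Sf(x)=\frac1x f(1/x)$. $\overline{b_n}$ denotes the complex-conjugate sequence. *)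

(* Defs.v *)
From HB Require Import structures.
From mathcomp Require Import all_boot all_order all_algebra.
From mathcomp Require Import all_classical all_reals all_analysis.
From mathcomp Require Import complex.
Set Implicit Arguments. Unset Strict Implicit. Unset Printing Implicit Defensive.
Import Order.TTheory GRing.Theory Num.Theory.
Import numFieldNormedType.Exports.
Local Open Scope classical_set_scope.
Local Open Scope ring_scope.

Section Defs.
Variable R : realType.
Local Notation C := (complex R).

(* Dirichlet convolution of sequences indexed from 1 (index 0 is ignored). *)
Definition dconv (a b : nat -> C) (k : nat) : C :=
  \sum_(d <- divisors k) a d * b (k %/ d)%N.

Definition dconv_inverse (a b : nat -> C) : Prop :=
  forall k : nat, (0 < k)%N -> dconv a b k = (k == 1%N)%:R.

Definition wsummable (w : nat -> R) (a : nat -> C) : Prop :=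
  (\sum_(1 <= n <oo) ((Normc.normc (a n) * w n)%:E) < +oo)%E.

(* complex value of a series sum_{n>=1} u_n, as the limit of partial sums
   (taken componentwise; arbitrary if it diverges) *)
Definition csum (u : nat -> C) : C :=
  Complex (limn (@series R (fun n => complex.Re (u n.+1)) : R^nat))
          (limn (@series R (fun n => complex.Im (u n.+1)) : R^nat)).

Definition Top (a : nat -> C) (f : R -> C) : R -> C :=
  fun x => csum (fun n => a n * f (n%:R * x)).

Definition Sop (f : R -> C) : R -> C :=
  fun x => Complex x^-1 0 * f x^-1.

Definition halfline : set R := `]0, +oo[%classic.

Definition mu := (@lebesgue_measure R).

Definition L2sq (f : R -> C) : \bar R :=
  (\int[mu]_(x in halfline) ((Normc.normc (f x)) ^+ 2)%:E)%E.

Definition L2 (f : R -> C) : Prop :=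
  [/\ measurable_fun halfline (fun x => complex.Re (f x)),
      measurable_fun halfline (fun x => complex.Im (f x))
    & (L2sq f < +oo)%E].

Definition ae_eq (f g : R -> C) : Prop :=
  {ae mu, forall x, halfline x -> f x = g x}.

Definition unitary_L2 (U : (R -> C) -> (R -> C)) : Prop :=
  [/\ forall f, L2 f -> L2 (U f),
      forall f g, L2 f -> L2 g -> ae_eq f g -> ae_eq (U f) (U g),
      forall (c : C) f g, L2 f -> L2 g ->
        ae_eq (U (fun x => c * f x + g x)) (fun x => c * U f x + U g x),
      forall f, L2 f -> L2sq (U f) = L2sq f
    & forall g, L2 g -> exists2 f, L2 f & ae_eq (U f) g].

Definition Fop (a b : nat -> C) : (R -> C) -> (R -> C) :=
  fun f => Top (fun n => conjc (b n)) (Sop (Top a f)).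

End Defs.

(* Main.v *)
(* On L^2(0,oo), with D_r f(x) = f(r x), T(a) is the sum of the a_n D_n, and S
   conjugates the unitary multiple r^(1/2) D_r of D_r to r^(-1/2) D_(1/r).
   Expanding squared norms shows |T(conj b) S g| = |T(b) g|: for finite sums the
   change of variables x -> 1/(m k x) turns each Gram entry of the functions
   (S g)(m x), (S g)(k x) into the conjugate of the one for g(m x), g(k x), and
   dominated convergence gives the general case.  As a * b = delta implies
   T(a) T(b) = T(b) T(a) = id almost everywhere, F is isometric:
   |T(conj b) S T(a) f| = |T(b) T(a) f| = |f|, and it maps
   T(b) S T(conj a) g to g because S is an involution. *)
Require Import Defs.
From HB Require Import structures.
From mathcomp Require Import all_boot all_order all_algebra.
From mathcomp Require Import all_classical all_reals all_analysis.
From mathcomp Require Import measurable_realfun.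
From mathcomp Require Import complex.
From mathcomp Require Import ring lra.
Import Order.TTheory GRing.Theory Num.Theory.
Import numFieldNormedType.Exports.
Local Open Scope ring_scope.

(** * The substitution [x -> 1 / (M x)] on the half line *)

Section inversion.
Context {R : realType}.
Context {M : R}.
Hypothesis M_gt0 : 0 < M.
Local Notation mu := (@lebesgue_measure R).
Local Notation halfline := (@halfline R).
Local Open Scope classical_set_scope.

(** [csum] is arbitrary where its series diverges, so pointwise operator identities are claimed
    almost everywhere only, and the analysis amounts to finding a set of full measure on which every
    series involved converges absolutely. The control is [majorant a f], the pointwise sum of the
    |a_n f(n x)|. Since f(n x) has L^2 norm n^(-1/2) times that of f, the integral of its square is
    at most (sum |a_n| / sqrt n)^2 times the squared norm of f. So the majorant is finite almost
    everywhere, and its square dominates the squared moduli of all partial sums. Being square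
    integrable, it can be fed to a second majorant, and this controls T(a) T(b). Only the
    substitution x -> 1/(M x) is proved from scratch, by uniqueness of measures; x -> c x is
    obtained as a composite of two of these. *)

Lemma halflineE (x : R) : halfline x = (0 < x) :> Prop.
Proof. by rewrite /halfline /= in_itv /= andbT. Qed.

Lemma measurable_halfline : measurable halfline.
Proof. exact: measurable_itv. Qed.

Lemma measurable_inv_halfline : measurable_fun halfline (@GRing.inv R).
Proof.
apply: open_continuous_measurable_fun; first exact: interval_open.
move=> x; rewrite inE halflineE => x0.
by apply: inv_continuous; rewrite gt_eqF.
Qed.

Lemma measurable_inversion :
  measurable_fun halfline (fun x : R => (M * x)^-1).
Proof.
under eq_fun do rewrite invfM.
by apply: measurable_funM => //; exact: measurable_inv_halfline.
Qed.

Lemma measurable_density :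
  measurable_fun halfline (fun x : R => (M * x ^+ 2)^-1).
Proof.
under eq_fun do rewrite invfM -exprVn.
by apply: measurable_funM => //; apply: measurable_funX; exact: measurable_inv_halfline.
Qed.

Let measurable_indic_inversion (A : set R) : measurable A ->
  measurable_fun halfline (fun x : R => \1_A ((M * x)^-1) : R).
Proof.
move=> mA; apply: (measurableT_comp _ measurable_inversion).
exact: measurable_indic.
Qed.

(** Image under y = 1/(M x) of the measure with density 1/(M x^2), the absolute value of dy/dx. The
    substitution rule amounts to this being Lebesgue measure on the half line. *)
Definition inversion_measure (A : set (measurableTypeR R)) : \bar R :=
  (\int[mu]_(x in halfline) ((M * x ^+ 2)^-1 * \1_A ((M * x)^-1))%:E)%E.

Let inversion_measure0 : inversion_measure set0 = 0%E.
Proof.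
by rewrite /inversion_measure integral0_eq// => x _; rewrite indic0 mulr0.
Qed.

Let inversion_measure_ge0 A : (0 <= inversion_measure A)%E.
Proof.
apply: integral_ge0 => x; rewrite halflineE => x0; rewrite lee_fin mulr_ge0//.
by rewrite invr_ge0 mulr_ge0 ?exprn_ge0// ltW.
Qed.

Let measurable_inversion_integrand (A : set R) : measurable A ->
  measurable_fun halfline
    (fun x : R => ((M * x ^+ 2)^-1 * \1_A ((M * x)^-1))%:E).
Proof.
move=> mA; apply/measurable_EFinP; apply: measurable_funM.
  exact: measurable_density.
exact: measurable_indic_inversion.
Qed.

Let inversion_measure_sigma_additive :
  semi_sigma_additive inversion_measure.
Proof.
move=> F mF tF mUF.
rewrite [X in _ --> X](_ : _ = \sum_(0 <= i <oo) inversion_measure (F i))%E.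
  by apply: is_cvg_nneseries => n _ _; exact: inversion_measure_ge0.
rewrite -integral_nneseries//=; last 3 first.
- exact: measurable_halfline.
- by move=> n; exact: (measurable_inversion_integrand _ (mF n)).
- move=> n x; rewrite halflineE => x0; rewrite lee_fin mulr_ge0//.
  by rewrite invr_ge0 mulr_ge0 ?exprn_ge0// ltW.
apply: eq_integral => x; rewrite inE halflineE => x0.
by rewrite EFinM indic_bigcup// -nneseriesZl//.
Qed.

HB.instance Definition _ := isMeasure.Build _ _ _ inversion_measure
  inversion_measure0 inversion_measure_ge0 inversion_measure_sigma_additive.

(** Rays generate the Borel sets, so this is the only computation needed. For b > 0 it integrates
    the density over the preimage of ]0, b[ with the antiderivative -1/(M x). *)
Let inversion_measure_ray (b : R) :
  inversion_measure `]-oo, b[ = mrestr mu measurable_halfline `]-oo, b[.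
Proof.
rewrite /mrestr.
have [b0|b0] := leP b 0.
  rewrite [X in mu X](_ : _ = set0) ?measure0.
    rewrite /inversion_measure integral0_eq// => x; rewrite halflineE => x0.
    rewrite indicE memNset ?mulr0//= in_itv/= => h.
    have : 0 < (M * x)^-1 by rewrite invr_gt0 mulr_gt0.
    by rewrite ltNge (le_trans (ltW h) b0).
  apply/seteqP; split=> x//=; rewrite halflineE in_itv/= => -[xb].
  by rewrite ltNge (le_trans (ltW xb) b0).
rewrite [X in mu X](_ : _ = `]0, b[%classic); last first.
  apply/seteqP; split=> x/=; rewrite halflineE !in_itv/=.
    by move=> [-> ->].
  by move=> /andP[-> ->].
rewrite lebesgue_measure_itv/= lte_fin b0 sube0.
(* The decreasing map x -> 1/(M x) sends c to b, so the preimage of ]0, b[ is ]c, +oo[. *)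
pose c := (M * b)^-1.
have c0 : 0 < c by rewrite invr_gt0 mulr_gt0.
transitivity (\int[mu]_(x in `]c, +oo[) ((M * x ^+ 2)^-1)%:E)%E.
  rewrite /inversion_measure.
  have hE : halfline = `]0, c] `|` `]c, +oo[ :> set R.
    apply/seteqP; split => x/=; rewrite halflineE !in_itv/= ?andbT.
      move=> ->/=; case: (leP x c); [by left|by right].
    by move=> [/andP[]//|]; apply: lt_trans.
  rewrite {1}hE ge0_integral_setU//=; last 3 first.
  - by have := measurable_inversion_integrand `]-oo, b[ (measurable_itv _); rewrite hE.
  - move=> x xU; have : halfline x by rewrite hE.
    rewrite halflineE => x0; rewrite lee_fin mulr_ge0//.
    by rewrite invr_ge0 mulr_ge0 ?exprn_ge0// ltW.
  - apply/disj_setPS => x /=; rewrite !in_itv/= andbT => -[/andP[_ xc]].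
    by rewrite ltNge xc.
  rewrite integral0_eq ?add0e; last first.
    move=> x /=; rewrite in_itv/= => /andP[x0 xc].
    rewrite indicE memNset ?mulr0//= in_itv/=; apply/negP.
    rewrite -leNgt -[leLHS]invrK lef_pV2 ?posrE ?mulr_gt0 ?invr_gt0//.
    by rewrite -ler_pdivlMl// -invfM.
  apply: eq_integral => x; rewrite inE/= in_itv/= andbT => cx.
  rewrite indicE mem_set ?mulr1//= in_itv/=.
  rewrite -[ltRHS]invrK ltf_pV2 ?posrE ?mulr_gt0 ?invr_gt0//.
    by rewrite -ltr_pdivrMl// -invfM.
  exact: lt_trans cx.
rewrite integral_itv_obnd_cbnd; last first.
  apply/measurable_EFinP; apply: measurable_funS measurable_density => //.
    exact: measurable_halfline.
  move=> x /=; rewrite halflineE in_itv/= andbT; exact: lt_trans.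
have cont (x : R) : 0 < x -> {for x, continuous (fun x : R => (M * x ^+ 2)^-1)}.
  move=> x0; apply: cvgV; first by rewrite gt_eqF// mulr_gt0// exprn_gt0.
  by apply: cvgM; [exact: cvg_cst|exact: exprn_continuous].
have derF (x : R) : 0 < x ->
    is_derive x (1 : R) (fun x : R => - (M * x)^-1) ((M * x ^+ 2)^-1).
  move=> x0; have Mx : M * x != 0 by rewrite gt_eqF// mulr_gt0.
  have dM : is_derive x (1 : R) (fun y : R => M * y) (M *: 1).
    exact: (is_deriveZ (f := id)).
  have := is_deriveN (is_deriveV Mx dM).
  set l := (X in is_derive _ _ _ X); rewrite (_ : l = (M * x ^+ 2)^-1)//.
  rewrite /l /GRing.scale/=; field; rewrite !gt_eqF//.
(* The 0 is the limit of -1/(M x) at infinity; the value at c is -b. *)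
rewrite (@ge0_continuous_FTC2y _ _ (fun x => - (M * x)^-1) _ 0)//.
- by rewrite sub0e -EFinN opprK /c; congr EFin; field; rewrite !gt_eqF.
- move=> x cx; rewrite invr_ge0 mulr_ge0 ?exprn_ge0// ltW//.
  exact: lt_le_trans cx.
- apply/continuous_within_itvcyP; split.
    move=> x; rewrite in_itv/= andbT => cx; apply: cont; exact: lt_trans cx.
  by apply: cvg_at_right_filter; exact: cont.
- rewrite -oppr0; apply: cvgN; apply/gtr0_cvgV0.
    by near=> x; rewrite mulr_gt0//; near: x; exact: nbhs_pinfty_gt.
  by apply: gt0_cvgMry => //; exact: cvg_id.
- by move=> x cx; case: (derF _ (lt_trans c0 cx)).
- apply: cvg_at_right_filter.
  by case: (derF _ c0) => /derivable1_diffP/differentiable_continuous.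
- move=> x; rewrite in_itv/= andbT => cx.
  by rewrite derive1E; case: (derF _ (lt_trans c0 cx)).
Unshelve. all: by end_near. Qed.

(** Two measures agreeing on a generating family closed under intersection coincide, provided the
    space is covered by members of finite measure, here the rays up to k. *)
Lemma inversion_measureE (A : set R) : measurable A ->
  inversion_measure A = mu (A `&` halfline).
Proof.
move=> mA; rewrite -[RHS]/(mrestr mu measurable_halfline A).
pose m1 : {measure set (measurableTypeR R) -> \bar R} := inversion_measure.
pose m2 : {measure set (measurableTypeR R) -> \bar R} := mrestr mu measurable_halfline.
apply: (@measure_unique _ R (measurableTypeR R) (@RGenInftyO.G R)
  (fun k => `]-oo, k%:R[%classic) _ _ _ _ m1 m2) => //.
- exact: RGenInftyO.measurableE.
- move=> _ _ [x ->] [y ->]; exists (Order.min x y).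
  by apply/seteqP; split=> z/=; rewrite !in_itv/= lt_min => /andP.
- by move=> k; exists k%:R.
- apply/seteqP; split=> // x _; exists (Num.truncn `|x|).+1 => //=.
  by rewrite in_itv/= (le_lt_trans (ler_norm _))// truncnS_gt.
- by move=> _ [b ->]; exact: inversion_measure_ray.
(* Only the part of the ray inside the half line has mass, and [0, k] contains it. *)
- move=> k; change (inversion_measure `]-oo, k%:R[ < +oo)%E.
  rewrite inversion_measure_ray /mrestr (@le_lt_trans _ _ (mu `[0, k%:R]))//.
    apply: le_measure; rewrite ?inE.
    - by apply: measurableI; [exact: measurable_itv|exact: measurable_halfline].
    - exact: measurable_itv.
   - move=> x [] /=; rewrite halflineE !in_itv/= => xk /ltW ->; exact: ltW.
  by rewrite lebesgue_measure_itv/=; case: ifPn => // _; rewrite -EFinB ltry.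
Qed.

Import HBNNSimple.

(** [inversion_measureE] is the case of indicators. Both sides are limits along the same increasing
    simple functions, and for these both equal the sum of the values weighted by the measures of the
    level sets. *)
Lemma ge0_integral_inversion (f : R -> \bar R) :
  measurable_fun halfline f -> (forall x, halfline x -> (0 <= f x)%E) ->
  (\int[mu]_(x in halfline) (((M * x ^+ 2)^-1)%R%:E * f ((M * x)^-1)%R) =
   \int[mu]_(x in halfline) f x)%E.
Proof.
move=> mf f0.
have mH := measurable_halfline.
have phiH (x : R) : halfline x -> halfline ((M * x)^-1).
  by rewrite !halflineE => x0; rewrite invr_gt0 mulr_gt0.
have h0 (x : R) : halfline x -> 0 <= (M * x ^+ 2)^-1.
  by rewrite halflineE => x0; rewrite invr_ge0 mulr_ge0 ?exprn_ge0// ltW.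
pose f_ := nnsfun_approx mH mf.
have nd_f (x : R) (m n : nat) : (m <= n)%N -> f_ m x <= f_ n x.
  by move=> mn; exact/lefP/nd_nnsfun_approx.
have cvg_f (x : R) : halfline x -> (EFin \o f_ ^~ x) @ \oo --> f x.
  by move=> xH; exact: cvg_nnsfun_approx.
have mphi (n : nat) : measurable_fun halfline (fun x => f_ n (M * x)^-1).
  exact: (measurableT_comp _ measurable_inversion).
transitivity (limn (fun n =>
    (\int[mu]_(x in halfline) ((M * x ^+ 2)^-1 * f_ n ((M * x)^-1))%:E)%E)).
  rewrite -monotone_convergence//.
  - apply: eq_integral => x; rewrite inE => xH; apply/esym/cvg_lim => //.
    under eq_fun do rewrite EFinM.
    by apply: cvgeZl => //; apply: cvg_f; exact: phiH.
  - move=> k; apply/measurable_EFinP; apply: measurable_funM.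
      exact: measurable_density.
    exact: mphi.
  - by move=> k x xH; rewrite lee_fin mulr_ge0// h0.
  - by move=> x xH m n mn; rewrite lee_fin ler_wpM2l// ?h0// nd_f.
transitivity (limn (fun n => (\int[mu]_(x in halfline) (f_ n x)%:E)%E)); last first.
  rewrite -monotone_convergence//.
  - by apply: eq_integral => x; rewrite inE => xH; apply/cvg_lim => //; exact: cvg_f.
  - by move=> n; apply/measurable_EFinP; apply: measurable_funTS;
      exact: (measurable_funP (f_ n)).
  - by move=> n x xH; rewrite lee_fin.
  - by move=> x xH m n mn; rewrite lee_fin nd_f.
congr (limn _); apply/funext => n.
have mfn (k : R) : measurable (f_ n @^-1` [set k]) by [].
have indic_ge0 (k x : R) : 0 <= k * \1_(f_ n @^-1` [set k]) x.
  by have := nnfun_muleindic_ge0 (f_ n) k x; rewrite -EFinM lee_fin.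
have swap (k c x : R) : c * (k * \1_(f_ n @^-1` [set k]) x) =
    k * (c * \1_(f_ n @^-1` [set k]) x) by rewrite mulrCA.
transitivity (\sum_(k \in range (f_ n)) (k%:E * mu (f_ n @^-1` [set k] `&` halfline))%E).
  transitivity (\int[mu]_(x in halfline) (\sum_(k \in range (f_ n))
     (k * ((M * x ^+ 2)^-1 * \1_(f_ n @^-1` [set k]) (M * x)^-1))%:E))%E.
    apply: eq_integral => x _; rewrite fimfunE fsumEFin// mulr_fsumr.
    by congr EFin; apply: eq_fsbigr => k _; exact: swap.
  rewrite ge0_integral_fsum//; last 2 first.
  - move=> k; apply/measurable_EFinP; apply: measurable_funM => //.
    apply: measurable_funM; first exact: measurable_density.
    exact: (measurable_indic_inversion _ (mfn k)).
  - by move=> k x xH; rewrite lee_fin -swap mulr_ge0// h0.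
  (* A constant leaves the integral only if nonnegative; for k < 0 the level set is empty and both
     sides vanish. *)
  apply: eq_fsbigr => k _; have [k0|k0] := ltP k 0.
    rewrite preimage_nnfun0// set0I measure0 mule0 integral0_eq// => x _.
    by rewrite indic0 !mulr0.
  under eq_integral do rewrite EFinM.
  rewrite ge0_integralZl_EFin//.
  - by congr (_ * _)%E; exact: inversion_measureE.
  - by move=> x xH; rewrite lee_fin mulr_ge0// h0.
  - exact: (measurable_inversion_integrand _ (mfn k)).
under [RHS]eq_integral do rewrite fimfunE -fsumEFin//.
rewrite ge0_integral_fsum//; last 2 first.
- move=> k; apply/measurable_EFinP; apply: measurable_funM; first exact: measurable_cst.
  by apply: measurable_indic; exact: mfn.
- by move=> k x _; rewrite lee_fin.
apply: eq_fsbigr => k _; have [k0|k0] := ltP k 0.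
  by rewrite preimage_nnfun0// set0I measure0 mule0 integral0_eq// => x _;
    rewrite indic0 mulr0.
under eq_integral do rewrite EFinM.
rewrite ge0_integralZl_EFin//.
- by congr (_ * _)%E; rewrite integral_indic//; exact: mfn.
- by apply/measurable_EFinP; apply: measurable_indic; exact: mfn.
Qed.

(** Needed for Gram entries, whose sign is not controlled. The density is nonnegative, so
    multiplying by it commutes with taking positive and negative parts. *)
Lemma integral_inversion (f : R -> \bar R) : measurable_fun halfline f ->
  (\int[mu]_(x in halfline) (((M * x ^+ 2)^-1)%R%:E * f ((M * x)^-1)%R) =
   \int[mu]_(x in halfline) f x)%E.
Proof.
move=> mf; rewrite integralE [RHS]integralE.
rewrite -[in RHS]ge0_integral_inversion//; last exact: measurable_funepos.
rewrite -[X in _ = (_ - X)%E]ge0_integral_inversion//; last exact: measurable_funeneg.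
have h0 (x : R) : halfline x -> 0 <= (M * x ^+ 2)^-1.
  by rewrite halflineE => x0; rewrite invr_ge0 mulr_ge0 ?exprn_ge0// ltW.
congr (_ - _)%E; apply: eq_integral => x; rewrite inE => xH.
  by rewrite !funeposE maxe_pMr ?mule0// ?lee_fin ?h0.
by rewrite !funenegE -muleN maxe_pMr ?mule0// ?lee_fin ?h0.
Qed.

(** The preimage of a null set N has integral [inversion_measure N] = 0 against a strictly positive
    density, hence is itself null. *)
Lemma ae_inversion (P : R -> Prop) :
  {ae mu, forall x, halfline x -> P x} ->
  {ae mu, forall x, halfline x -> P (M * x)^-1}.
Proof.
move=> [N [mN N0 PN]].
have h0 (x : R) : halfline x -> 0 < (M * x ^+ 2)^-1.
  by rewrite halflineE => x0; rewrite invr_gt0 mulr_gt0// exprn_gt0.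
have mI : measurable_fun halfline (fun x : R => ((M * x ^+ 2)^-1 * \1_N (M * x)^-1)%:E).
  exact: measurable_inversion_integrand.
have : ae_eq mu halfline (fun x : R => ((M * x ^+ 2)^-1 * \1_N (M * x)^-1)%:E) (cst 0%E).
  have [+ _] := ae_eq_integral_abs mu measurable_halfline mI; apply.
  rewrite -[RHS](_ : inversion_measure N = 0%E); last first.
    rewrite inversion_measureE//; apply/eqP; rewrite eq_le measure_ge0 andbT.
    rewrite -N0; apply: le_measure; rewrite ?inE//.
    exact: measurableI measurable_halfline.
  apply: eq_integral => x; rewrite inE => xH.
  by rewrite gee0_abs// lee_fin mulr_ge0// ltW// h0.
apply: filterS => x /= + xH => /(_ xH) [] /eqP.
rewrite mulf_eq0 gt_eqF ?h0//= => xN.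
apply: contrapT => nP; move: xN; rewrite indicE mem_set ?oner_eq0//.
apply: PN => /= /(_ _); apply: contra_not nP; apply.
by move: xH; rewrite !halflineE => x0; rewrite invr_gt0 mulr_gt0.
Qed.

End inversion.

(** * Complex series *)

Section complex_series.
Context {R : realType}.
Local Notation C := (complex R).
Local Notation normc := (@Normc.normc R).
Local Notation Re := (@complex.Re R).
Local Notation Im := (@complex.Im R).
Local Open Scope classical_set_scope.
Implicit Types (z w : C) (u v : nat -> C).

Lemma normc_ge0 z : 0 <= normc z.
Proof. by case: z => x y; exact: sqrtr_ge0. Qed.

Lemma sqr_normcE z : normc z ^+ 2 = Re z ^+ 2 + Im z ^+ 2.
Proof. by case: z => x y /=; rewrite sqr_sqrtr// addr_ge0// sqr_ge0. Qed.

Lemma normr_Re_le z : `|Re z| <= normc z.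
Proof.
rewrite -(ler_pXn2r (n := 2))// ?nnegrE ?normc_ge0// sqr_normcE.
by rewrite real_normK ?num_real// lerDl sqr_ge0.
Qed.

Lemma normr_Im_le z : `|Im z| <= normc z.
Proof.
rewrite -(ler_pXn2r (n := 2))// ?nnegrE ?normc_ge0// sqr_normcE.
by rewrite real_normK ?num_real// lerDr sqr_ge0.
Qed.

Lemma normc_conj z : normc (conjc z) = normc z.
Proof. by case: z => x y /=; rewrite sqrrN. Qed.

Lemma normc_real (x : R) : normc (Complex x 0) = `|x|.
Proof. by rewrite /= expr0n addr0 sqrtr_sqr. Qed.

Lemma ReM z w : Re (z * w) = Re z * Re w - Im z * Im w.
Proof. by case: z w => [x y] [x' y']. Qed.

Lemma ImM z w : Im (z * w) = Re z * Im w + Im z * Re w.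
Proof. by case: z w => [x y] [x' y']. Qed.

Lemma ReD z w : Re (z + w) = Re z + Re w.
Proof. by case: z w => [x y] [x' y']. Qed.

Lemma ImD z w : Im (z + w) = Im z + Im w.
Proof. by case: z w => [x y] [x' y']. Qed.

Lemma Re_sum I (r : seq I) (P : pred I) (F : I -> C) :
  Re (\sum_(i <- r | P i) F i) = \sum_(i <- r | P i) Re (F i).
Proof. by apply: (big_morph _ ReD). Qed.

Lemma Im_sum I (r : seq I) (P : pred I) (F : I -> C) :
  Im (\sum_(i <- r | P i) F i) = \sum_(i <- r | P i) Im (F i).
Proof. by apply: (big_morph _ ImD). Qed.

Lemma complex_eqP z w : Re z = Re w -> Im z = Im w -> z = w.
Proof. by case: z w => [x y] [x' y'] /= -> ->. Qed.

Lemma normc_sum_le I (r : seq I) (P : pred I) (F : I -> C) :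
  normc (\sum_(i <- r | P i) F i) <= \sum_(i <- r | P i) normc (F i).
Proof.
elim/big_ind2 : _ => // [|x1 x2 y1 y2 h1 h2]; first by rewrite Normc.normc0.
by rewrite (le_trans (le_normcD _ _))// lerD.
Qed.

Definition abs_csummable u := cvgn (series (fun n => normc (u n.+1)) : R^nat).

Lemma abs_csummableP u :
  (\sum_(n <oo) (normc (u n.+1))%:E < +oo)%E <-> abs_csummable u.
Proof.
split=> [|cu]; first by apply: nnseries_is_cvg => n; exact: normc_ge0.
have /cvg_lim : (EFin \o series (fun n => normc (u n.+1))) @ \oo -->
    (limn (series (fun n => normc (u n.+1))))%:E by apply: cvg_EFin => //; exact: nearW.
rewrite (_ : EFin \o _ = (fun N => \sum_(0 <= n < N) (normc (u n.+1))%:E)%E).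
  by move=> ->//; rewrite ltry.
by apply/funext => N /=; rewrite /series/= sumEFin.
Qed.

Lemma is_cvg_csum u : abs_csummable u ->
  cvgn (series (fun n => Re (u n.+1)) : R^nat) /\
  cvgn (series (fun n => Im (u n.+1)) : R^nat).
Proof.
by move=> cu; split; apply: normed_cvg; apply: series_le_cvg cu => n //=;
  rewrite ?normc_ge0 ?normr_ge0 ?normr_Re_le ?normr_Im_le.
Qed.

Lemma abs_csummableZ (c : C) u : abs_csummable u -> abs_csummable (fun n => c * u n).
Proof.
move=> cu; rewrite /abs_csummable.
under eq_fun do rewrite Normc.normcM.
exact: is_cvg_seriesZ.
Qed.

Lemma csumD u v : abs_csummable u -> abs_csummable v ->
  csum (fun n => u n + v n) = csum u + csum v.
Proof.
move=> /is_cvg_csum[Ru Iu] /is_cvg_csum[Rv Iv].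
apply: complex_eqP; rewrite ?ReD ?ImD /= -lim_seriesD//.
  by congr (limn (series _)); apply/funext => n; exact: ReD.
by congr (limn (series _)); apply/funext => n; exact: ImD.
Qed.

Lemma csumZ (c : C) u : abs_csummable u -> csum (fun n => c * u n) = c * csum u.
Proof.
move=> /is_cvg_csum[]; set ru := fun n => Re _; set iu := fun n => Im _ => Ru Iu.
have cR (k : R) : cvgn (series (k *: ru)) by exact: is_cvg_seriesZ.
have cI (k : R) : cvgn (series (k *: iu)) by exact: is_cvg_seriesZ.
apply: complex_eqP.
  transitivity (limn (series (Re c *: ru - Im c *: iu)) : R).
    by congr (limn (series _)); apply/funext => n; exact: ReM.
  by rewrite ReM lim_seriesB// !lim_seriesZ.
transitivity (limn (series (Re c *: iu + Im c *: ru)) : R).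
  by congr (limn (series _)); apply/funext => n; exact: ImM.
by rewrite ImM lim_seriesD// !lim_seriesZ.
Qed.

Lemma eq_csum u v : (forall n, (0 < n)%N -> u n = v n) -> csum u = csum v.
Proof.
move=> uv; rewrite /csum; congr Complex;
  by congr (limn (series _)); apply/funext => n; rewrite uv.
Qed.

Lemma csum_single u : (forall n, (1 < n)%N -> u n = 0) -> csum u = u 1%N.
Proof.
move=> u0; have h (f : nat -> R) : (forall n, (0 < n)%N -> f n = 0) ->
    limn (series f) = f 0%N.
  move=> f0; apply/cvg_lim => //.
  apply: (@cvg_trans _ ((cst (f 0%N) : R^nat) @ \oo)); last exact: cvg_cst.
  apply: near_eq_cvg; near=> n.
  have n0 : (0 < n)%N by near: n; exact: nbhs_infty_gt.
  rewrite /series/= -(prednK n0) big_nat_recl// big1_seq ?addr0// => i _.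
  by rewrite f0.
by apply: complex_eqP; rewrite /= h// => n n0; rewrite u0.
Unshelve. all: by end_near. Qed.

End complex_series.

(** * Grouping double series by the product of the indices *)

Section dirichlet_rearrangement.
Context {R : realType}.
Local Open Scope classical_set_scope.
Local Open Scope ereal_scope.

(** Turns the divisor sum into a sum over an initial segment of the integers, which can be extended
    by zeros to a full series. *)
Lemma big_divisors (k : nat) (F : nat -> \bar R) : (0 < k)%N ->
  \sum_(d <- divisors k) F d = \sum_(0 <= m < k | (m.+1 %| k)%N) F m.+1.
Proof.
move=> k0; rewrite -[RHS]big_filter -(big_map succn xpredT).
apply: perm_big; apply: uniq_perm.
- exact: divisors_uniq.
- rewrite map_inj_uniq; last exact: succn_inj.
  by rewrite filter_uniq// iota_uniq.
- move=> d; rewrite -dvdn_divisors//; apply/idP/mapP => [dk|[m + ->]].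
    have d0 := dvdn_gt0 k0 dk.
    exists d.-1; last by rewrite prednK.
    by rewrite mem_filter mem_index_iota prednK// dk/= dvdn_leq.
  by rewrite mem_filter => /andP[].
Qed.

(** The multiples of m+1 are the (m+1)(n+1); the predecessors in the reindexing undo the shift of
    all indices by one. *)
Lemma nneseries_multiples (m : nat) (p : nat -> \bar R) : (forall n, 0 <= p n) ->
  \sum_(k <oo) (if (m.+1 %| k.+1)%N then p (k.+1 %/ m.+1)%N else 0) =
  \sum_(n <oo) p n.+1.
Proof.
move=> p0; rewrite -eseries_mkcond !nneseries_esum//.
rewrite (reindex_esum [set _ : nat | true] _ (fun n => (m.+1 * n.+1).-1)%N).
  by apply: eq_esum => n _; rewrite prednK ?muln_gt0// mulKn.
split.
- by move=> n _; rewrite /mkset prednK ?muln_gt0// dvdn_mulr.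
- move=> n n' _ _ /(congr1 succn); rewrite !prednK ?muln_gt0// => /eqP.
  by rewrite eqn_mul2l/= eqSS => /eqP.
- move=> k; rewrite /mkset => /dvdnP[q kq].
  have q0 : (0 < q)%N by case: q kq.
  by exists q.-1; rewrite // prednK// mulnC -kq.
Qed.

(** Tonelli for the array [q], which vanishes unless m+1 divides k+1: summed by k it gives divisor
    sums, summed by m it gives sums over multiples. *)
Lemma nneseries_divisors (p : nat -> nat -> \bar R) : (forall m n, 0 <= p m n) ->
  \sum_(k <oo) \sum_(d <- divisors k.+1) p d (k.+1 %/ d)%N =
  \sum_(m <oo) \sum_(n <oo) p m.+1 n.+1.
Proof.
move=> p0.
pose q m k := if (m.+1 %| k.+1)%N then p m.+1 (k.+1 %/ m.+1)%N else 0.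
have q0 m k : 0 <= q m k by rewrite /q; case: ifP.
transitivity (\sum_(k <oo) \sum_(m <oo) q m k).
  apply: eq_eseriesr => k _; rewrite big_divisors//.
  (* The tail vanishes because a divisor of k+1 cannot exceed k+1. *)
  rewrite (nneseries_split _ k.+1)// big_mkcond/= add0n [X in _ + X]eseries0 ?adde0//.
  move=> m km _; rewrite /q; case: ifP => // /dvdn_leq.
  by rewrite ltnNge => /(_ isT); rewrite leqNgt ltnS km.
rewrite nneseries_interchange//; apply: eq_eseriesr => m _.
exact: nneseries_multiples.
Qed.

End dirichlet_rearrangement.

Section real_rearrangement.
Context {R : realType}.
Local Open Scope classical_set_scope.

Lemma limn_series_fine (h : nat -> R) : (forall n, 0 <= h n) ->
  (\sum_(n <oo) (h n)%:E < +oo)%E ->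
  cvgn (series h) /\ (\sum_(n <oo) (h n)%:E)%E = (limn (series h))%:E.
Proof.
move=> h0 hoo; have ch := nnseries_is_cvg h0 hoo; split=> //.
have /cvg_lim <- // : (EFin \o series h) @ \oo --> (limn (series h))%:E.
  by apply: cvg_EFin => //; exact: nearW.
by congr (limn _); apply/funext => N; rewrite /series/= sumEFin.
Qed.

Definition double_summable (w : nat -> nat -> R) :=
  (\sum_(m <oo) \sum_(n <oo) `|w m.+1 n.+1|%:E < +oo)%E.

Lemma nneseries_term_lty (h : nat -> \bar R) m : (forall n, 0 <= h n)%E ->
  (\sum_(n <oo) h n < +oo)%E -> (h m < +oo)%E.
Proof.
move=> h0; apply: le_lt_trans.
apply: le_trans (@nneseries_lim_ge R h xpredT 0%N m.+1 (fun n _ _ => h0 n)).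
by rewrite big_nat_recr//= leeDr// sume_ge0.
Qed.

(** Transfers the extended-real identity to [limn]. The convergence claims are recorded because
    limits of differences are taken later. *)
Let ge0_rearrangement (p : nat -> nat -> R) : (forall m n, 0 <= p m n) ->
  double_summable p ->
  [/\ forall m, cvgn (series (fun n => p m.+1 n.+1)),
     cvgn (series (fun m => limn (series (fun n => p m.+1 n.+1)))),
     cvgn (series (fun k => \sum_(d <- divisors k.+1) p d (k.+1 %/ d)%N)) &
  limn (series (fun m => limn (series (fun n => p m.+1 n.+1)))) =
  limn (series (fun k => \sum_(d <- divisors k.+1) p d (k.+1 %/ d)%N)) ].
Proof.
move=> p0 ps.
have : (\sum_(m <oo) \sum_(n <oo) (p m.+1 n.+1)%:E < +oo)%E.
  rewrite (le_lt_trans _ ps)//; apply: lee_nneseries => [m _ _|m _].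
    by apply: nneseries_ge0 => n _ _; rewrite lee_fin.
  by apply: lee_nneseries => n *; rewrite lee_fin// ler_norm.
move=> {}ps.
have rowlt m : (\sum_(n <oo) (p m.+1 n.+1)%:E < +oo)%E.
  apply: (nneseries_term_lty (fun m => \sum_(n <oo) (p m.+1 n.+1)%:E)%E m) => // i.
  by apply: nneseries_ge0 => n _ _; rewrite lee_fin.
have row m := limn_series_fine _ (fun n => p0 m.+1 n.+1) (rowlt m).
have rowc m := (row m).1.
have rowE m := (row m).2.
have row0 m : 0 <= limn (series (fun n => p m.+1 n.+1)).
  by rewrite -lee_fin -rowE; apply: nneseries_ge0 => n _ _; rewrite lee_fin.
move: (ps); under eq_eseriesr do rewrite rowE.
move=> /(limn_series_fine _ row0)[c1 e1].
have divE : (\sum_(k <oo) (\sum_(d <- divisors k.+1) p d (k.+1 %/ d)%N)%:E =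
    \sum_(m <oo) \sum_(n <oo) (p m.+1 n.+1)%:E)%E.
  rewrite -(nneseries_divisors (fun m n => (p m n)%:E)); last first.
    by move=> m n; rewrite lee_fin.
  by apply: eq_eseriesr => k _; rewrite sumEFin.
have d0 k : 0 <= \sum_(d <- divisors k.+1) p d (k.+1 %/ d)%N.
  by apply: sumr_ge0.
move: ps; rewrite -divE => /(limn_series_fine _ d0)[c2 e2].
split => //; apply: EFin_inj; rewrite -e1 -e2 divE.
by apply: eq_eseriesr => m _; rewrite rowE.
Qed.

(** Writes w as |w| - (|w| - w), a difference of nonnegative arrays; the second is at most 2|w|,
    hence also summable. *)
Lemma series_rearrangement (w : nat -> nat -> R) : double_summable w ->
  limn (series (fun m => limn (series (fun n => w m.+1 n.+1)))) =
  limn (series (fun k => \sum_(d <- divisors k.+1) w d (k.+1 %/ d)%N)).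
Proof.
move=> ws; pose p m n : R := `|w m n|; pose q m n : R := `|w m n| - w m n.
have p0 m n : 0 <= p m n by exact: normr_ge0.
have q0 m n : 0 <= q m n by rewrite subr_ge0 ler_norm.
have ps : double_summable p.
  by move: ws; rewrite /double_summable /p; under [in X in _ -> X]eq_eseriesr do
    under eq_eseriesr do rewrite normr_id.
have qs : double_summable q.
  have : (2%:E * (\sum_(m <oo) \sum_(n <oo) `|w m.+1 n.+1|%:E) < +oo)%E.
    exact: lte_mul_pinfty.
  rewrite /double_summable; apply: le_lt_trans; rewrite -nneseriesZl; last first.
    by move=> m _; apply: nneseries_ge0 => n _ _; rewrite lee_fin.
  apply: lee_nneseries => [m _ _|m _].
    by apply: nneseries_ge0 => n _ _; rewrite lee_fin.
  rewrite -nneseriesZl; last by move=> n _; rewrite lee_fin.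
  apply: lee_nneseries => [n _ _|n _]; first by rewrite lee_fin.
  rewrite -EFinM lee_fin (ger0_norm (q0 _ _)) /q mulr_natl mulr2n.
  by rewrite lerD2l -normrN ler_norm.
have [cp1 cp2 cp3 ep] := ge0_rearrangement p p0 ps.
have [cq1 cq2 cq3 eq] := ge0_rearrangement q q0 qs.
have wE m n : w m n = p m n - q m n by rewrite /p /q opprB addrC subrK.
transitivity (limn (series ((fun m => limn (series (fun n => p m.+1 n.+1))) -
    (fun m => limn (series (fun n => q m.+1 n.+1))))) : R).
  congr (limn (series _)); apply/funext => m.
  transitivity (limn (series ((fun n => p m.+1 n.+1) - (fun n => q m.+1 n.+1))) : R).
    by congr (limn (series _)); apply/funext => n; exact: wE.
  by rewrite lim_seriesB.
rewrite lim_seriesB// ep eq -lim_seriesB//.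
congr (limn (series _)); apply/funext => k.
transitivity (\sum_(d <- divisors k.+1) p d (k.+1 %/ d)%N -
              \sum_(d <- divisors k.+1) q d (k.+1 %/ d)%N) => //.
rewrite -sumrB; apply: eq_bigr => d _; exact/esym/wE.
Qed.

End real_rearrangement.

Section complex_rearrangement.
Context {R : realType}.
Local Notation C := (complex R).
Local Notation normc := (@Normc.normc R).
Local Notation Re := (@complex.Re R).
Local Notation Im := (@complex.Im R).
Local Open Scope classical_set_scope.

Lemma csum_rearrangement (w : nat -> nat -> C) :
  double_summable (fun m n => normc (w m n)) ->
  csum (fun m => csum (fun n => w m n)) =
  csum (fun k => \sum_(d <- divisors k) w d (k %/ d)%N).
Proof.
move=> ws; rewrite {1}/csum; apply: complex_eqP => /=.
  transitivity (limn (series (fun k =>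
      \sum_(d <- divisors k.+1) Re (w d (k.+1 %/ d)%N)))).
    rewrite -(series_rearrangement (fun m n => Re (w m n)))//.
    apply: le_lt_trans ws; apply: lee_nneseries => [m _ _|m _].
      by apply: nneseries_ge0 => n _ _; rewrite lee_fin.
    apply: lee_nneseries => [n _ _|n _]; rewrite lee_fin//.
    by rewrite [leRHS]ger0_norm ?normc_ge0// normr_Re_le.
  by congr (limn (series _)); apply/funext => k; rewrite Re_sum.
transitivity (limn (series (fun k =>
    \sum_(d <- divisors k.+1) Im (w d (k.+1 %/ d)%N)))).
  rewrite -(series_rearrangement (fun m n => Im (w m n)))//.
  apply: le_lt_trans ws; apply: lee_nneseries => [m _ _|m _].
    by apply: nneseries_ge0 => n _ _; rewrite lee_fin.
  apply: lee_nneseries => [n _ _|n _]; rewrite lee_fin//.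
  by rewrite [leRHS]ger0_norm ?normc_ge0// normr_Im_le.
by congr (limn (series _)); apply/funext => k; rewrite Im_sum.
Qed.

(** With v k = f(k x), this is T(a) T(b) f = T(a * b) f at one point x. Convergence of the rows is
    asked separately: where [a m] vanishes, double summability says nothing about row m. *)
Lemma csum_dconv (a b v : nat -> C) :
  double_summable (fun m n => normc (a m * (b n * v (m * n)%N))) ->
  (forall m, (0 < m)%N -> abs_csummable (fun n => b n * v (m * n)%N)) ->
  csum (fun m => a m * csum (fun n => b n * v (m * n)%N)) =
  csum (fun k => dconv a b k * v k).
Proof.
move=> ds cb.
transitivity (csum (fun m => csum (fun n => a m * (b n * v (m * n)%N)))).
  by apply: eq_csum => m m0; rewrite csumZ//; exact: cb.
rewrite csum_rearrangement//; apply: eq_csum => k k0.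
rewrite /dconv mulr_suml big_seq [RHS]big_seq; apply: eq_bigr => d.
by rewrite -dvdn_divisors// => dk; rewrite mulrA mulnC divnK.
Qed.

End complex_rearrangement.

(** * Measurability of pointwise limits *)

Section measurable_lim.
Context d (T : measurableType d) {R : realType}.
Local Open Scope classical_set_scope.
Variables (D : set T) (mD : measurable D).

(* [limn] is [0] at the points where the sequence diverges. *)
Lemma measurable_fun_limn (h : nat -> T -> R) :
  (forall n, measurable_fun D (h n)) ->
  measurable_fun D (fun x => limn (h ^~ x)).
Proof.
move=> mh.
pose E x := limn_esup (fun n => (h n x)%:E).
pose I x := limn_einf (fun n => (h n x)%:E).
have mE : measurable_fun D E.
  by apply: measurable_fun_limn_esup => n; exact/measurable_EFinP.
have IE x : I x = (- limn_esup (fun n => (- (h n x))%:E))%E.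
  by rewrite -[LHS]oppeK -limn_esupN.
have mI : measurable_fun D I.
  rewrite (funext IE); apply: (measurableT_comp (f := -%E)).
    exact: oppe_measurable.
  have mN n : measurable_fun D (fun x => (- h n x)%:E).
    by apply/measurable_EFinP; exact: measurable_funN.
  exact: measurable_fun_limn_esup mN.
(* The set of convergence: the upper and lower limits agree and are finite. The limit is
   [fine (E x)] on it and 0 on the rest of [D], so it is measurable once [K] is. *)
pose K := D `&` (E \- I)%E @^-1` [set 0%E] `&`
  (D `&` E @^-1` ~` ([set +oo%E] `|` [set -oo%E])).
have mK : measurable K.
  apply: measurableI.
    by apply: (emeasurable_funB mE mI) => //; exact: emeasurable_set1.
  apply: mE => //; apply: measurableC.
  by apply: measurableU; exact: emeasurable_set1.
have KP x : D x -> K x <-> cvgn (h ^~ x).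
  move=> Dx; split.
    move=> [[_ /= EI] [_ /= Eoo]].
    have Efin : E x \is a fin_num.
      by rewrite fin_numE; apply/andP; split; apply/eqP => Ex; apply: Eoo; [right|left].
    have {}EI : I x = E x.
      move: EI Efin; case: (E x) => // e; case: (I x) => // r [] /eqP.
      by rewrite subr_eq0 => /eqP ->.
    suff /fine_cvgP[_ cx] : (fun n => (h n x)%:E) @ \oo --> (fine (E x))%:E.
      by apply/cvg_ex; exists (fine (E x)).
    rewrite fineK//; apply: (@squeeze_cvge _ _ _ _ (einfs (fun n => (h n x)%:E)) _
      (esups (fun n => (h n x)%:E))).
    - apply: nearW => n; apply/andP; split.
        by apply: ereal_inf_lbound; exists n => /=.
      by apply: ereal_sup_ubound; exists n => /=.
    - by rewrite -EI /I limn_einf_lim; exact: is_cvg_einfs.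
    - by rewrite /E limn_esup_lim; exact: is_cvg_esups.
  move=> cx.
  have cEx : (EFin \o h ^~ x) @ \oo --> (limn (h ^~ x))%:E.
    by apply: cvg_EFin => //; exact: nearW.
  have [eI eE] := cvg_limn_einf_sup cEx.
  split; split=> //=; rewrite /E /I ?eI ?eE ?subee//.
  by move=> [].
apply: (eq_measurable_fun ((fine \o E) \_ K)).
  move=> x; rewrite inE => Dx; rewrite patchE.
  case: ifPn => [|]; rewrite ?inE ?notin_setE.
    move=> /(KP _ Dx) cx /=.
    have cEx : (EFin \o h ^~ x) @ \oo --> (limn (h ^~ x))%:E.
      by apply: cvg_EFin => //; exact: nearW.
    by rewrite /E (cvg_limn_einf_sup cEx).2.
  by move=> nK; rewrite dvgP// => /(KP _ Dx).
apply/measurable_restrict => //.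
apply: (measurable_funS mD); first by move=> x [].
by apply: measurableT_comp => //; exact: fine_measurable.
Qed.

End measurable_lim.

(** * Square integrable functions *)

Section dilation.
Context {R : realType}.
Local Notation mu := (@lebesgue_measure R).
Local Notation halfline := (@halfline R).
Local Open Scope classical_set_scope.

Lemma measurable_comp_halfline d (U : measurableType d) (phi : R -> R) (f : R -> U) :
  (forall x, halfline x -> halfline (phi x)) ->
  measurable_fun halfline phi -> measurable_fun halfline f ->
  measurable_fun halfline (f \o phi).
Proof.
move=> phiH mphi mf; apply: (measurable_comp _ _ mf mphi).
  exact: measurable_halfline.
by move=> _ [x xH <-]; exact: phiH.
Qed.

Lemma measurable_dilation d (U : measurableType d) (f : R -> U) (c : R) : 0 < c ->
  measurable_fun halfline f -> measurable_fun halfline (fun x => f (c * x)).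
Proof.
move=> c0; apply: (@measurable_comp_halfline _ _ (fun x => c * x)).
  by move=> x; rewrite !halflineE => x0; rewrite mulr_gt0.
exact: mulrl_measurable.
Qed.

(** x -> 1/x followed by y -> 1/(c^-1 y) is x -> c x. The product of the two densities is the
    constant c, which the factor c^-1 cancels. *)
Lemma ge0_integral_dilation (f : R -> \bar R) (c : R) : 0 < c ->
  measurable_fun halfline f -> (forall x, halfline x -> (0 <= f x)%E) ->
  (\int[mu]_(x in halfline) f (c * x)%R =
   c^-1%:E * \int[mu]_(x in halfline) f x)%E.
Proof.
move=> c0 mf f0.
have ci0 : 0 < c^-1 by rewrite invr_gt0.
have H (y : R) : 0 < y -> 0 < (c^-1 * y)^-1.
  by move=> y0; rewrite invr_gt0 mulr_gt0.
pose g (x : R) := (((c^-1 * x ^+ 2)^-1)%R%:E * f ((c^-1 * x)^-1)%R)%E.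
rewrite -(ge0_integral_inversion ci0 _ mf f0)
  -[X in (_ * X)%E]/(\int[mu]_(x in halfline) g x)%E.
have g0 x : halfline x -> (0 <= g x)%E.
  rewrite halflineE => x0; apply: mule_ge0.
    by rewrite lee_fin invr_ge0 mulr_ge0 ?exprn_ge0// ltW.
  by apply: f0; rewrite halflineE H.
have mg : measurable_fun halfline g.
  apply: emeasurable_funM.
    by apply/measurable_EFinP; exact: measurable_density.
  apply: (@measurable_comp_halfline _ _ (fun x => (c^-1 * x)^-1)) => //.
    by move=> x; rewrite !halflineE; exact: H.
  exact: measurable_inversion.
rewrite -(ge0_integral_inversion ltr01 _ mg g0) -ge0_integralZl//; last 4 first.
- exact: measurable_halfline.
- apply: emeasurable_funM.
    by apply/measurable_EFinP; exact: measurable_density.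
  apply: (@measurable_comp_halfline _ _ (fun x => (1 * x)^-1)) => //.
    by move=> x; rewrite !halflineE mul1r invr_gt0.
  exact: measurable_inversion.
- move=> x xH; apply: mule_ge0.
    by rewrite lee_fin mul1r invr_ge0 exprn_ge0// ltW// -halflineE.
  by apply: g0; move: xH; rewrite !halflineE mul1r invr_gt0.
- by rewrite lee_fin ltW.
apply: eq_integral => x; rewrite inE halflineE => x0; rewrite /g !mul1r.
rewrite !muleA -!EFinM (_ : c^-1 * _ * _ = 1)%R; last first.
  by field; rewrite !gt_eqF.
by rewrite mul1e invfM !invrK.
Qed.

Lemma ae_halflineS (P Q : R -> Prop) :
  (forall x, halfline x -> P x -> Q x) ->
  {ae mu, forall x, halfline x -> P x} -> {ae mu, forall x, halfline x -> Q x}.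
Proof.
move=> PQ [N [mN N0 PN]]; exists N; split=> // x nQ; apply: PN => /= h.
by apply: nQ => xH; apply: PQ => //; exact: h.
Qed.

Lemma ae_halflineI (P Q : R -> Prop) :
  {ae mu, forall x, halfline x -> P x} -> {ae mu, forall x, halfline x -> Q x} ->
  {ae mu, forall x, halfline x -> P x /\ Q x}.
Proof.
move=> hP hQ; have := @negligibleU _ _ R mu _ _ hP hQ.
apply: negligibleS => x /= nPQ; apply: contrapT => /not_orP[/contrapT p /contrapT q].
by apply: nPQ => xH; split; [exact: p|exact: q].
Qed.

Lemma ae_dilation (P : R -> Prop) (c : R) : 0 < c ->
  {ae mu, forall x, halfline x -> P x} ->
  {ae mu, forall x, halfline x -> P (c * x)}.
Proof.
move=> c0; have ci0 : 0 < c^-1 by rewrite invr_gt0.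
move=> /(ae_inversion ci0) /(ae_inversion ltr01).
by apply: ae_halflineS => x _; rewrite mul1r invfM !invrK.
Qed.

End dilation.

(** * The square integrable majorant *)

Section L2_theory.
Context {R : realType}.
Local Notation mu := (@lebesgue_measure R).
Local Notation halfline := (@halfline R).
Local Notation C := (complex R).
Local Notation normc := (@Normc.normc R).
Local Notation Re := (@complex.Re R).
Local Notation Im := (@complex.Im R).
Local Open Scope classical_set_scope.
Implicit Types (f g : R -> C) (a b : nat -> C).

Definition cmeasurable f := measurable_fun halfline (fun x => Re (f x)) /\
  measurable_fun halfline (fun x => Im (f x)).

Lemma L2E f : L2 f <-> cmeasurable f /\ (L2sq f < +oo)%E.
Proof. by split => [[]|[[]]]. Qed.

Lemma measurable_normc f : cmeasurable f ->
  measurable_fun halfline (fun x => normc (f x)).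
Proof.
move=> [mRe mIm]; rewrite (_ : (fun x => _) =
    (fun x => Num.sqrt (Re (f x) ^+ 2 + Im (f x) ^+ 2))); last first.
  by apply/funext => x; case: (f x).
apply: (measurableT_comp (f := @Num.sqrt R)).
  by apply: continuous_measurable_fun; exact: sqrt_continuous.
by apply: measurable_funD; exact: measurable_funX.
Qed.

Lemma measurable_normc2 f : cmeasurable f ->
  measurable_fun halfline (fun x => (normc (f x) ^+ 2)%:E).
Proof.
by move=> mf; apply/measurable_EFinP; apply: measurable_funX; exact: measurable_normc.
Qed.

Lemma cmeasurableM f g : cmeasurable f -> cmeasurable g ->
  cmeasurable (fun x => f x * g x).
Proof.
move=> [Rf If] [Rg Ig]; split.
  under eq_fun do rewrite ReM.
  by apply: measurable_funB; exact: measurable_funM.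
under eq_fun do rewrite ImM.
by apply: measurable_funD; exact: measurable_funM.
Qed.

Lemma cmeasurable_cst (c : C) : cmeasurable (fun=> c).
Proof. by split; exact: measurable_cst. Qed.

Lemma cmeasurableD f g : cmeasurable f -> cmeasurable g ->
  cmeasurable (fun x => f x + g x).
Proof.
move=> [Rf If] [Rg Ig]; split.
  by under eq_fun do rewrite ReD; exact: measurable_funD.
by under eq_fun do rewrite ImD; exact: measurable_funD.
Qed.

Lemma cmeasurable_conj f : cmeasurable f -> cmeasurable (fun x => conjc (f x)).
Proof.
move=> [Rf If]; split.
  rewrite (_ : (fun x => _) = (fun x => Re (f x)))//.
  by apply/funext => x; case: (f x).
rewrite (_ : (fun x => _) = (fun x => - Im (f x))).
  exact: measurable_funN.
by apply/funext => x; case: (f x).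
Qed.

Lemma cmeasurable_dilation f (c : R) : 0 < c -> cmeasurable f ->
  cmeasurable (fun x => f (c * x)).
Proof.
move=> c0 [Rf If]; split.
  exact: (measurable_dilation _ _ _ _ c0 Rf).
exact: (measurable_dilation _ _ _ _ c0 If).
Qed.

Lemma cmeasurable_sum (I : Type) (r : seq I) (F : I -> R -> C) :
  (forall i, cmeasurable (F i)) -> cmeasurable (fun x => \sum_(i <- r) F i x).
Proof.
move=> mF; elim: r => [|i r ih].
  by under eq_fun do rewrite big_nil; exact: cmeasurable_cst.
by under eq_fun do rewrite big_cons; exact: cmeasurableD.
Qed.

Lemma L2sq_ge0 f : (0 <= L2sq f)%E.
Proof. by apply: integral_ge0 => x _; rewrite lee_fin exprn_ge0// normc_ge0. Qed.

Lemma L2sq_ae f g : cmeasurable f -> cmeasurable g -> Defs.ae_eq f g ->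
  L2sq f = L2sq g.
Proof.
move=> mf mg fg; apply: ge0_ae_eq_integral.
- exact: measurable_halfline.
- exact: measurable_normc2.
- exact: measurable_normc2.
- by move=> x _; rewrite lee_fin exprn_ge0// normc_ge0.
- by move=> x _; rewrite lee_fin exprn_ge0// normc_ge0.
- by apply: ae_halflineS fg => x _ ->.
Qed.

(** Bound for the operator norm of T(a): the factor 1/sqrt n is the norm of f -> f(n x). *)
Definition weight a : \bar R :=
  (\sum_(n <oo) (normc (a n.+1) / Num.sqrt n.+1%:R)%:E)%E.

(** Extended-real valued, since the series may diverge at exceptional points; its finiteness at x is
    absolute convergence of T(a) f(x). *)
Definition majorant a f (x : R) : \bar R :=
  (\sum_(n <oo) (normc (a n.+1 * f (n.+1%:R * x)))%:E)%E.

Lemma weightE a :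
  wsummable (fun n => (Num.sqrt (n%:R : R))^-1) a <-> (weight a < +oo)%E.
Proof.
rewrite /wsummable /weight -(@nneseries_addn _
  (fun n => (normc (a n) * (Num.sqrt (n%:R : R))^-1)%:E) 1%N).
  by under eq_eseriesr do rewrite addn1.
by move=> n; rewrite lee_fin mulr_ge0// ?normc_ge0// invr_ge0 sqrtr_ge0.
Qed.

Lemma weight_ge0 a : (0 <= weight a)%E.
Proof.
by apply: nneseries_ge0 => n _ _; rewrite lee_fin divr_ge0// ?normc_ge0 ?sqrtr_ge0.
Qed.

Lemma majorant_ge0 a f x : (0 <= majorant a f x)%E.
Proof. by apply: nneseries_ge0 => n _ _; rewrite lee_fin normc_ge0. Qed.

Lemma cauchy_schwarz_weighted (w z : nat -> R) N : (forall n, 0 <= w n) ->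
  (\sum_(0 <= n < N) w n * z n) ^+ 2 <=
  (\sum_(0 <= n < N) w n) * (\sum_(0 <= n < N) w n * z n ^+ 2).
Proof.
move=> w0; elim: N => [|N ih]; first by rewrite !big_nil expr0n mul0r.
rewrite !big_nat_recr//=; move: ih.
have W0 : 0 <= \sum_(0 <= n < N) w n by rewrite sumr_ge0.
have Q0 : 0 <= \sum_(0 <= n < N) w n * z n ^+ 2.
  by rewrite sumr_ge0// => i _; rewrite mulr_ge0// sqr_ge0.
move: W0 Q0 (w0 N).
set W := \sum_(0 <= n < N) w n; set Q := \sum_(0 <= n < N) w n * z n ^+ 2.
set P := \sum_(0 <= n < N) w n * z n; move: (w N) (z N) => v y W0 Q0 v0 PWQ.
(* Expanding the squares, the induction hypothesis P^2 <= W Q leaves exactly this. If W = 0 then P =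
   0; otherwise, after multiplication by W, the bracket is at least (W y - P)^2. *)
suff : 0 <= v * (W * y ^+ 2 + Q - 2 * P * y) by nra.
apply: mulr_ge0 => //; move: W0; rewrite le_eqVlt => /predU1P[W0|W0].
  have -> : P = 0.
    by apply/eqP; rewrite -sqrf_eq0 eq_le sqr_ge0 andbT (le_trans PWQ)// -W0 mul0r.
  by rewrite -W0 mul0r add0r mulr0 mul0r subr0.
rewrite -(pmulr_rge0 _ W0).
have := sqr_ge0 (W * y - P); nra.
Qed.

(* Cauchy-Schwarz with the weights [|a_n| / sqrt n], so that the right-hand
   side scales well under integration over [x]. *)
Lemma majorant_sqr_le a f (x : R) :
  (majorant a f x * majorant a f x <= weight a *
   \sum_(n <oo) (normc (a n.+1) * Num.sqrt n.+1%:R * normc (f (n.+1%:R * x)) ^+ 2)%:E)%E.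
Proof.
set Q := (\sum_(n <oo) _)%E.
pose S N := (\sum_(0 <= n < N) (normc (a n.+1 * f (n.+1%:R * x)))%:E)%E.
have cS : S @ \oo --> majorant a f x.
  by apply: is_cvg_nneseries => n _ _; rewrite lee_fin normc_ge0.
have cSS : (fun N => S N * S N)%E @ \oo --> (majorant a f x * majorant a f x)%E.
  apply: cvgeM => //.
  by have := majorant_ge0 a f x; case: (majorant a f x) => //= r _;
    rewrite /mule_def/=; case: ifP.
rewrite -(cvg_lim _ cSS)//; apply: lime_le; first by apply/cvg_ex; eexists; exact: cSS.
apply: nearW => N.
have sqrt0 n : (Num.sqrt n.+1%:R : R) != 0 by rewrite gt_eqF// sqrtr_gt0.
have w0 n : 0 <= normc (a n.+1) / Num.sqrt n.+1%:R.
  by rewrite divr_ge0// ?normc_ge0 ?sqrtr_ge0.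
have q0 n : 0 <= normc (a n.+1) * Num.sqrt n.+1%:R * normc (f (n.+1%:R * x)) ^+ 2.
  by rewrite !mulr_ge0 ?normc_ge0 ?sqrtr_ge0 ?exprn_ge0 ?normc_ge0.
apply: (@le_trans _ _ ((\sum_(0 <= n < N) (normc (a n.+1) / Num.sqrt n.+1%:R))%:E *
  (\sum_(0 <= n < N) (normc (a n.+1) * Num.sqrt n.+1%:R *
      normc (f (n.+1%:R * x)) ^+ 2))%:E)%E).
  rewrite /S sumEFin -!EFinM lee_fin -expr2.
  (* The choice z_n = sqrt n |f(n x)| makes w_n z_n equal to |a_n f(n x)|. *)
  have := cauchy_schwarz_weighted (fun n => normc (a n.+1) / Num.sqrt n.+1%:R)
    (fun n => Num.sqrt n.+1%:R * normc (f (n.+1%:R * x))) N w0.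
  congr (_ ^+ 2 <= _ * _).
    by apply: eq_bigr => n _; rewrite Normc.normcM mulrA divfK.
  by apply: eq_bigr => n _; rewrite exprMn expr2 !mulrA divfK.
apply: lee_pmul.
- by rewrite lee_fin sumr_ge0.
- by rewrite lee_fin sumr_ge0.
- rewrite -sumEFin; apply: nneseries_lim_ge => n _ _; exact: w0.
- rewrite -sumEFin; apply: nneseries_lim_ge => n _ _; exact: q0.
Qed.

Lemma cmeasurable_term a f n : cmeasurable f ->
  cmeasurable (fun x => a n.+1 * f (n.+1%:R * x)).
Proof.
move=> mf; apply: cmeasurableM; first exact: cmeasurable_cst.
exact: cmeasurable_dilation.
Qed.

Lemma measurable_majorant a f : cmeasurable f ->
  measurable_fun halfline (majorant a f).
Proof.
move=> mf; apply: ge0_emeasurable_sum.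
  by move=> n x _ _; rewrite lee_fin normc_ge0.
move=> n _; apply/measurable_EFinP; apply: measurable_normc.
exact: cmeasurable_term.
Qed.

(** Termwise integration of the weighted bound: the integral of |f(n x)|^2 is 1/n times that of
    |f|^2, which turns |a_n| sqrt n into |a_n| / sqrt n and yields the second factor [weight a]. *)
Lemma integral_majorant_sqr_le a f : L2 f ->
  (\int[mu]_(x in halfline) (majorant a f x * majorant a f x) <=
   weight a * (weight a * L2sq f))%E.
Proof.
move=> /L2E[mf f2]; have mH := @measurable_halfline R.
have ffin : L2sq f \is a fin_num by rewrite ge0_fin_numE ?L2sq_ge0.
pose q n (x : R) := (normc (a n.+1) * Num.sqrt n.+1%:R * normc (f (n.+1%:R * x)) ^+ 2)%:E.
have q0 n x : (0 <= q n x)%E.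
  by rewrite lee_fin !mulr_ge0 ?normc_ge0 ?sqrtr_ge0 ?exprn_ge0 ?normc_ge0.
have mfn n : measurable_fun halfline (fun x => (normc (f (n.+1%:R * x)) ^+ 2)%:E).
  by apply: measurable_normc2; exact: cmeasurable_dilation.
have mq n : measurable_fun halfline (q n).
  apply/measurable_EFinP; apply: measurable_funM => //.
  by apply: measurable_funX; apply: measurable_normc; exact: cmeasurable_dilation.
have mQ : measurable_fun halfline (fun x => \sum_(n <oo) q n x)%E.
  by apply: ge0_emeasurable_sum.
apply: (@le_trans _ _ (\int[mu]_(x in halfline) (weight a * \sum_(n <oo) q n x))%E).
  apply: ge0_le_integral => //.
  - by move=> x _; apply: mule_ge0; exact: majorant_ge0.
  - by apply: emeasurable_funM; exact: measurable_majorant.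
  - by apply: emeasurable_funM.
  - by move=> x _; exact: majorant_sqr_le.
rewrite ge0_integralZl//; last 2 first.
- by move=> x _; apply: nneseries_ge0.
- exact: weight_ge0.
rewrite lee_wpmul2l//; first exact: weight_ge0.
rewrite integral_nneseries//.
rewrite muleC -(fineK ffin) /weight -nneseriesZl; last first.
  by move=> n _; rewrite lee_fin divr_ge0// ?normc_ge0 ?sqrtr_ge0.
apply: lee_nneseries => [n _ _|n _]; first by apply: integral_ge0 => x _; exact: q0.
rewrite /q; under eq_integral do rewrite EFinM.
rewrite ge0_integralZl//; last 2 first.
- by move=> x _; rewrite lee_fin exprn_ge0// normc_ge0.
- by rewrite lee_fin mulr_ge0// ?normc_ge0 ?sqrtr_ge0.
rewrite (ge0_integral_dilation (fun x => (normc (f x) ^+ 2)%:E))//.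
- rewrite (fineK ffin) muleA -EFinM muleC lee_wpmul2l// ?L2sq_ge0// lee_fin.
  have r0 : Num.sqrt (n.+1%:R : R) != 0 by rewrite gt_eqF// sqrtr_gt0.
  have := sqr_sqrtr (ler0n R n.+1).
  move: (Num.sqrt _) r0 => r r0 <-; rewrite le_eqVlt; apply/orP; left; apply/eqP.
  by field.
- exact: measurable_normc2.
- by move=> x _; rewrite lee_fin exprn_ge0// normc_ge0.
- exact: mfn.
Qed.

Lemma integrable_majorant_sqr a f : (weight a < +oo)%E -> L2 f ->
  mu.-integrable halfline (fun x => majorant a f x * majorant a f x)%E.
Proof.
move=> wa Lf; have /L2E[mf f2] := Lf; apply/integrableP; split.
  by apply: emeasurable_funM; exact: measurable_majorant.
under eq_integral do rewrite gee0_abs ?mule_ge0 ?majorant_ge0//.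
rewrite (le_lt_trans (integral_majorant_sqr_le a f Lf))//.
have wfin : weight a \is a fin_num by rewrite ge0_fin_numE ?weight_ge0.
by apply: lte_mul_pinfty; rewrite ?weight_ge0//; apply: lte_mul_pinfty; rewrite ?weight_ge0.
Qed.

Lemma ae_majorant_lty a f : (weight a < +oo)%E -> L2 f ->
  {ae mu, forall x, halfline x -> (majorant a f x < +oo)%E}.
Proof.
move=> wa Lf.
have mH : measurable (halfline : set (measurableTypeR R)) by exact: measurable_halfline.
have := integrable_ae mH (integrable_majorant_sqr a f wa Lf).
apply: ae_halflineS => x _; have := majorant_ge0 a f x.
by case: (majorant a f x) => //= r _; rewrite ltry.
Qed.

End L2_theory.

(** * The operators [T] and [S] *)

Section Top_theory.
Context {R : realType}.
Local Notation mu := (@lebesgue_measure R).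
Local Notation halfline := (@halfline R).
Local Notation C := (complex R).
Local Notation normc := (@Normc.normc R).
Local Notation Re := (@complex.Re R).
Local Notation Im := (@complex.Im R).
Local Open Scope classical_set_scope.
Implicit Types (f g : R -> C) (a b : nat -> C).

Let mH : measurable (halfline : set (measurableTypeR R)).
Proof. exact: measurable_halfline. Qed.

(** Measurability must also cover the points where the series diverges, as [measurable_fun_limn]
    does. *)
Lemma cmeasurable_Top a f : cmeasurable f -> cmeasurable (Top a f).
Proof.
move=> mf; split.
  apply: (measurable_fun_limn _ _ _ measurable_halfline
    (fun N x => series (fun n => Re (a n.+1 * f (n.+1%:R * x))) N)) => N.
  by apply: measurable_sum => n; have [] := cmeasurable_term a f n mf.
apply: (measurable_fun_limn _ _ _ measurable_halfline
  (fun N x => series (fun n => Im (a n.+1 * f (n.+1%:R * x))) N)) => N.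
by apply: measurable_sum => n; have [] := cmeasurable_term a f n mf.
Qed.

Definition Tpartial a f N (x : R) : C :=
  \sum_(0 <= n < N) a n.+1 * f (n.+1%:R * x).

Lemma cmeasurable_Tpartial a f N : cmeasurable f -> cmeasurable (Tpartial a f N).
Proof. by move=> mf; apply: cmeasurable_sum => n; exact: cmeasurable_term. Qed.

Lemma majorant_abs_csummable a f (x : R) : (majorant a f x < +oo)%E ->
  abs_csummable (fun n => a n * f (n%:R * x)).
Proof. by move=> mx; apply/abs_csummableP. Qed.

Lemma normc_Tpartial_le a f N x : ((normc (Tpartial a f N x))%:E <= majorant a f x)%E.
Proof.
apply: (@le_trans _ _ (\sum_(0 <= n < N) (normc (a n.+1 * f (n.+1%:R * x)))%:E)%E).
  by rewrite sumEFin lee_fin normc_sum_le.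
by apply: nneseries_lim_ge => n _ _; rewrite lee_fin normc_ge0.
Qed.

Lemma cvg_Tpartial a f (x : R) : (majorant a f x < +oo)%E ->
  (fun N => (normc (Tpartial a f N x) ^+ 2)%:E) @ \oo --> (normc (Top a f x) ^+ 2)%:E.
Proof.
move=> /majorant_abs_csummable/is_cvg_csum[cR cI].
apply: cvg_EFin; first exact: nearW.
rewrite sqr_normcE (_ : _ \o _ = fun N =>
    (series (fun n => Re (a n.+1 * f (n.+1%:R * x))) N) ^+ 2 +
    (series (fun n => Im (a n.+1 * f (n.+1%:R * x))) N) ^+ 2); last first.
  by apply/funext => N /=; rewrite sqr_normcE /Tpartial Re_sum Im_sum.
by apply: cvgD; rewrite expr2; under eq_fun do rewrite expr2; apply: cvgM.
Qed.

(** Dominated convergence with the squared majorant. Convergence of the norms is what reduces norm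
    identities to finite sums. *)
Lemma Top_dominated a f : (weight a < +oo)%E -> L2 f ->
  L2 (Top a f) /\ (fun N => L2sq (Tpartial a f N)) @ \oo --> L2sq (Top a f).
Proof.
move=> wa Lf; have /L2E[mf _] := Lf.
have mT := cmeasurable_Top a f mf.
have := ae_majorant_lty a f wa Lf => maj.
have [|||||iT _ cT] := @dominated_convergence _ (measurableTypeR R) R mu halfline mH
  (fun N x => (normc (Tpartial a f N x) ^+ 2)%:E)
  (fun x => (normc (Top a f x) ^+ 2)%:E)
  (fun x => majorant a f x * majorant a f x)%E.
- by move=> N; apply: measurable_normc2; exact: cmeasurable_Tpartial.
- exact: measurable_normc2.
- apply: ae_halflineS maj => x _; exact: cvg_Tpartial.
- exact: integrable_majorant_sqr.
- apply: aeW => x N _; rewrite gee0_abs ?lee_fin ?exprn_ge0 ?normc_ge0//.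
  by rewrite expr2 EFinM lee_pmul ?lee_fin ?normc_ge0 ?normc_Tpartial_le.
split=> //; apply/L2E; split=> //; rewrite /L2sq.
have /integrableP[_] := iT; apply: le_lt_trans.
rewrite le_eqVlt; apply/orP; left; apply/eqP; apply: eq_integral => x _.
by rewrite gee0_abs// lee_fin exprn_ge0// normc_ge0.
Qed.

Lemma cmeasurable_Sop f : cmeasurable f -> cmeasurable (Sop f).
Proof.
move=> [mRe mIm]; apply: cmeasurableM.
  by split; [exact: measurable_inv_halfline|exact: measurable_cst].
have iH (x : R) : halfline x -> halfline x^-1 by rewrite !halflineE invr_gt0.
split.
  exact: (measurable_comp_halfline _ _ _ _ iH measurable_inv_halfline mRe).
exact: (measurable_comp_halfline _ _ _ _ iH measurable_inv_halfline mIm).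
Qed.

Lemma L2sq_Sop f : cmeasurable f -> L2sq (Sop f) = L2sq f.
Proof.
move=> mf; rewrite [RHS]/L2sq -(ge0_integral_inversion ltr01)//.
- apply: eq_integral => x; rewrite inE halflineE => x0.
  rewrite /Sop Normc.normcM normc_real exprMn !mul1r -EFinM.
  by rewrite ger0_norm ?invr_ge0 ?ltW// exprVn.
- exact: measurable_normc2.
- by move=> x _; rewrite lee_fin exprn_ge0// normc_ge0.
Qed.

Lemma L2_Sop f : L2 f -> L2 (Sop f).
Proof.
by move=> /L2E[mf f2]; apply/L2E; rewrite L2sq_Sop//; split=> //; exact: cmeasurable_Sop.
Qed.

Lemma SopK f x : halfline x -> Sop (Sop f) x = f x.
Proof.
rewrite halflineE => x0; rewrite /Sop invrK mulrA.
have -> : Complex x^-1 0 * Complex x 0 = 1 :> C.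
  by apply: complex_eqP; rewrite ?ReM ?ImM /= ?mulVf ?gt_eqF//; ring.
by rewrite mul1r.
Qed.

Lemma ae_Sop f g : Defs.ae_eq f g -> Defs.ae_eq (Sop f) (Sop g).
Proof.
move=> fg; have := @ae_inversion _ _ ltr01 _ fg.
by apply: ae_halflineS => x _; rewrite mul1r /Sop => ->.
Qed.

(** The values at x involve f at all n x: the exceptional set is a countable union of dilated null
    sets. *)
Lemma ae_Top a f g : Defs.ae_eq f g -> Defs.ae_eq (Top a f) (Top a g).
Proof.
move=> fg.
have : {ae mu, forall x, forall n, halfline x -> f (n.+1%:R * x) = g (n.+1%:R * x)}.
  by apply: ae_foralln => n; exact: (ae_dilation _ _ (ltr0Sn R n) fg).
move=> /= [N [mN N0 PN]]; exists N; split=> // x nT; apply: PN => /= h.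
apply: nT => xH; apply: eq_csum => -[//|n] _; by rewrite h.
Qed.

Lemma L2sq_dilation f (c : R) : 0 < c -> cmeasurable f ->
  L2sq (fun x => f (c * x)) = (c^-1%:E * L2sq f)%E.
Proof.
move=> c0 mf; apply: (ge0_integral_dilation (fun x => (normc (f x) ^+ 2)%:E)) => //.
  exact: measurable_normc2.
by move=> x _; rewrite lee_fin exprn_ge0// normc_ge0.
Qed.

Lemma L2_dilation f (c : R) : 0 < c -> L2 f -> L2 (fun x => f (c * x)).
Proof.
move=> c0 /L2E[mf f2]; apply/L2E; split; first exact: cmeasurable_dilation.
rewrite L2sq_dilation//; apply: lte_mul_pinfty => //.
by rewrite lee_fin invr_ge0 ltW.
Qed.

End Top_theory.

(** * Gram expansion of finite sums, and the effect of S on it *)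

Section Gram.
Context {R : realType}.
Local Notation mu := (@lebesgue_measure R).
Local Notation halfline := (@halfline R).
Local Notation C := (complex R).
Local Notation normc := (@Normc.normc R).
Local Notation Re := (@complex.Re R).
Local Notation Im := (@complex.Im R).
Local Open Scope classical_set_scope.
Implicit Types (f g : R -> C).

Let mH : measurable (halfline : set (measurableTypeR R)).
Proof. exact: measurable_halfline. Qed.

(** From |f g| <= |f|^2 + |g|^2. *)
Let integrable_dominated (h : R -> R) f g : L2 f -> L2 g ->
  measurable_fun halfline h -> (forall x, `|h x| <= normc (f x * conjc (g x))) ->
  mu.-integrable halfline (fun x => (h x)%:E).
Proof.
move=> /L2E[mf f2] /L2E[mg g2] mh hfg; apply/integrableP; split.
  exact/measurable_EFinP.
have N0 (k : R -> C) x : (0 <= (normc (k x) ^+ 2)%:E)%E.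
  by rewrite lee_fin exprn_ge0// normc_ge0.
apply: (@le_lt_trans _ _ (\int[mu]_(x in halfline)
   ((normc (f x) ^+ 2)%:E + (normc (g x) ^+ 2)%:E))%E).
  apply: ge0_le_integral => //.
  - by apply: measurableT_comp => //; exact/measurable_EFinP.
  - by apply: emeasurable_funD; exact: measurable_normc2.
  - move=> x _; rewrite -EFinD lee_fin (le_trans (hfg x))//.
    rewrite Normc.normcM normc_conj.
    have := sqr_ge0 (normc (f x) - normc (g x)).
    have := normc_ge0 (f x); have := normc_ge0 (g x); nra.
rewrite ge0_integralD//; try exact: measurable_normc2.
exact: lte_add_pinfty.
Qed.

Let cmeasurable_conjM f g : L2 f -> L2 g -> cmeasurable (fun x => f x * conjc (g x)).
Proof.
move=> /L2E[mf _] /L2E[mg _]; apply: cmeasurableM => //.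
exact: cmeasurable_conj.
Qed.

Lemma integrable_Re_conjM f g : L2 f -> L2 g ->
  mu.-integrable halfline (fun x => (Re (f x * conjc (g x)))%:E).
Proof.
move=> Lf Lg; have [mR _] := cmeasurable_conjM f g Lf Lg.
by apply: (integrable_dominated _ f g) => // x; exact: normr_Re_le.
Qed.

Lemma integrable_Im_conjM f g : L2 f -> L2 g ->
  mu.-integrable halfline (fun x => (Im (f x * conjc (g x)))%:E).
Proof.
move=> Lf Lg; have [_ mI] := cmeasurable_conjM f g Lf Lg.
by apply: (integrable_dominated _ f g) => // x; exact: normr_Im_le.
Qed.

Lemma sqr_normc_conj (z : C) : normc z ^+ 2 = Re (z * conjc z).
Proof. by case: z => x y; rewrite sqr_normcE ReM /= mulrN opprK !expr2. Qed.

(** Expands |z|^2 = Re (z conj z). The complex inner products appear as pairs of real integrals,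
    whence the minus sign of Re (z w) on the imaginary parts. *)
Lemma L2sq_sum (c : nat -> C) (u : nat -> R -> C) N : (forall n, L2 (u n)) ->
  L2sq (fun x => \sum_(0 <= n < N) c n * u n x) =
  (\sum_(0 <= i < N) \sum_(0 <= j < N)
     ((Re (c i * conjc (c j)))%:E *
        \int[mu]_(x in halfline) (Re (u i x * conjc (u j x)))%:E +
      (- Im (c i * conjc (c j)))%:E *
        \int[mu]_(x in halfline) (Im (u i x * conjc (u j x)))%:E))%E.
Proof.
move=> Lu.
pose G i j x := ((Re (c i * conjc (c j)))%:E * (Re (u i x * conjc (u j x)))%:E +
   (- Im (c i * conjc (c j)))%:E * (Im (u i x * conjc (u j x)))%:E)%E.
have iRe i j := integrable_Re_conjM _ _ (Lu i) (Lu j).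
have iIm i j := integrable_Im_conjM _ _ (Lu i) (Lu j).
have iG i j : mu.-integrable halfline (G i j).
  apply: (integrableD mH); apply: (integrableZl mH); [exact: iRe|exact: iIm].
transitivity (\int[mu]_(x in halfline) \sum_(0 <= i < N) \sum_(0 <= j < N) G i j x)%E.
  apply: eq_integral => x _; rewrite sqr_normc_conj rmorph_sum/= mulr_suml Re_sum.
  rewrite -sumEFin; apply: eq_bigr => i _; rewrite mulr_sumr Re_sum -sumEFin.
  apply: eq_bigr => j _; rewrite /G -!EFinM -EFinD; congr EFin.
  by rewrite mulNr -ReM rmorphM mulrACA.
rewrite (integral_sum mH); last by move=> i; apply: (integrable_sum mH) => j _; exact: iG.
apply: eq_bigr => i _; rewrite (integral_sum mH); last by move=> j; exact: iG.
apply: eq_bigr => j _.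
rewrite (integralD mH); last 2 first.
- exact: (integrableZl mH _ (iRe i j)).
- exact: (integrableZl mH _ (iIm i j)).
by rewrite (integralZl mH (iRe i j)) (integralZl mH (iIm i j)).
Qed.

Lemma L2sq_Tpartial_Sop (b : nat -> C) g N : L2 g ->
  L2sq (Tpartial (fun n => conjc (b n)) (Sop g) N) = L2sq (Tpartial b g N).
Proof.
move=> Lg; have LSg := L2_Sop _ Lg.
have pos n : 0 < n.+1%:R :> R by rewrite ltr0Sn.
rewrite (L2sq_sum (fun n => conjc (b n.+1)) (fun n x => Sop g (n.+1%:R * x))); last first.
  by move=> n; exact: L2_dilation.
rewrite (L2sq_sum (fun n => b n.+1) (fun n x => g (n.+1%:R * x))); last first.
  by move=> n; exact: L2_dilation.
apply: eq_bigr => i _; apply: eq_bigr => j _.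
have Li := L2_dilation _ _ (pos i) Lg; have Lj := L2_dilation _ _ (pos j) Lg.
have [mRe mIm] := cmeasurable_conjM _ _ Lj Li.
have M0 : 0 < i.+1%:R * j.+1%:R :> R by rewrite mulr_gt0.
(* For y = 1/(i j x) one has j y = 1/(i x) and i y = 1/(j x), so the indices trade places; the two
   factors of S multiply to 1/(i j x^2), the density for M = i j. *)
have SE (x : R) : 0 < x ->
   Sop g (i.+1%:R * x) * conjc (Sop g (j.+1%:R * x)) =
   Complex (i.+1%:R * j.+1%:R * x ^+ 2)^-1 0 *
   (g (j.+1%:R * (i.+1%:R * j.+1%:R * x)^-1) *
    conjc (g (i.+1%:R * (i.+1%:R * j.+1%:R * x)^-1))).
  move=> x0; rewrite /Sop rmorphM/= mulrACA.
  have -> : j.+1%:R * (i.+1%:R * j.+1%:R * x)^-1 = (i.+1%:R * x)^-1.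
    by field; rewrite !gt_eqF.
  have -> : i.+1%:R * (i.+1%:R * j.+1%:R * x)^-1 = (j.+1%:R * x)^-1.
    by field; rewrite !gt_eqF.
  congr (_ * _); apply: complex_eqP; rewrite ?ReM ?ImM /=; field; rewrite !gt_eqF//.
have eRe : (\int[mu]_(x in halfline)
    (Re (Sop g (i.+1%:R * x) * conjc (Sop g (j.+1%:R * x))))%:E =
    \int[mu]_(x in halfline) (Re (g (i.+1%:R * x) * conjc (g (j.+1%:R * x))))%:E)%E.
  transitivity (\int[mu]_(x in halfline)
      (Re (g (j.+1%:R * x) * conjc (g (i.+1%:R * x))))%:E)%E.
    rewrite -[RHS](integral_inversion M0); last exact/measurable_EFinP.
    apply: eq_integral => x; rewrite inE halflineE => x0.
    by rewrite SE// ReM/= mul0r subr0 EFinM.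
  apply: eq_integral => x _; congr EFin; rewrite !ReM.
  by case: (g _) => ? ?; case: (g _) => ? ? /=; ring.
have eIm : (\int[mu]_(x in halfline)
    (Im (Sop g (i.+1%:R * x) * conjc (Sop g (j.+1%:R * x))))%:E =
    (-1)%:E * \int[mu]_(x in halfline) (Im (g (i.+1%:R * x) * conjc (g (j.+1%:R * x))))%:E)%E.
  rewrite -integralZl//; last exact: (integrable_Im_conjM _ _ Li Lj).
  transitivity (\int[mu]_(x in halfline)
      (Im (g (j.+1%:R * x) * conjc (g (i.+1%:R * x))))%:E)%E.
    rewrite -[RHS](integral_inversion M0); last exact/measurable_EFinP.
    apply: eq_integral => x; rewrite inE halflineE => x0.
    by rewrite SE// ImM/= mul0r addr0 EFinM.
  apply: eq_integral => x _; rewrite -EFinM; congr EFin; rewrite !ImM.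
  by case: (g _) => ? ?; case: (g _) => ? ? /=; ring.
(* Swapping the indices has changed the sign of the imaginary integral; conjugating the coefficients
   changes the sign of their imaginary part, and the two cancel. *)
rewrite eRe eIm muleA -EFinM; congr (_%:E * _ + _%:E * _)%E.
  by rewrite !ReM; case: (b _) => ? ?; case: (b _) => ? ? /=; ring.
by rewrite !ImM; case: (b _) => ? ?; case: (b _) => ? ? /=; ring.
Qed.

Lemma L2sq_Top_Sop (b : nat -> C) g : (weight b < +oo)%E -> L2 g ->
  L2sq (Top (fun n => conjc (b n)) (Sop g)) = L2sq (Top b g).
Proof.
move=> wb Lg; have [_ c1] := Top_dominated b g wb Lg.
have wb' : (weight (fun n => conjc (b n)) < +oo)%E.
  by move: wb; rewrite /weight; under [in X in _ -> X]eq_eseriesr do rewrite normc_conj.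
have [_] := Top_dominated _ _ wb' (L2_Sop _ Lg).
under eq_fun do rewrite L2sq_Tpartial_Sop//.
by move=> c2; exact: (cvg_unique _ c2 c1).
Qed.

End Gram.

(** * Invertibility and unitarity *)

Section dconv_theory.
Context {R : realType}.
Local Notation C := (complex R).
Implicit Types a b : nat -> C.

(** By the involution d -> k/d of the divisors of k. *)
Lemma dconvC a b k : (0 < k)%N -> dconv a b k = dconv b a k.
Proof.
move=> k0; rewrite /dconv.
have dK d : (d %| k)%N -> (k %/ (k %/ d) = d)%N.
  move=> dk; have d0 := dvdn_gt0 k0 dk.
  by rewrite -[X in (X %/ _)%N](divnK dk) mulKn// divn_gt0// dvdn_leq.
have dvd_quo d : (d %| k)%N -> (k %/ d %| k)%N.
  by move=> dk; apply/dvdnP; exists d; rewrite mulnC divnK.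
have -> : \sum_(d <- divisors k) a d * b (k %/ d)%N =
    \sum_(d <- [seq (k %/ d)%N | d <- divisors k]) a d * b (k %/ d)%N.
  apply: perm_big; apply: uniq_perm; first exact: divisors_uniq.
    rewrite map_inj_in_uniq ?divisors_uniq// => d e.
    by rewrite -!dvdn_divisors// => dk ek de; rewrite -(dK d dk) de dK.
  move=> d; apply/idP/mapP => [dk|[e ek ->]].
    exists (k %/ d)%N; last by rewrite dK// dvdn_divisors.
    by rewrite -dvdn_divisors// dvd_quo// dvdn_divisors.
  by rewrite -dvdn_divisors// dvd_quo// dvdn_divisors.
rewrite big_map big_seq [RHS]big_seq; apply: eq_bigr => d.
by rewrite -dvdn_divisors// => dk; rewrite dK// mulrC.
Qed.

Lemma dconv_inverseC a b : dconv_inverse a b -> dconv_inverse b a.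
Proof. by move=> ab k k0; rewrite dconvC// ab. Qed.

Lemma dconv_inverse_conj a b : dconv_inverse a b ->
  dconv_inverse (fun n => conjc (a n)) (fun n => conjc (b n)).
Proof.
move=> ab k k0; rewrite -(rmorph_nat (@conjc R)) -ab// /dconv rmorph_sum.
by apply: eq_bigr => d _; rewrite rmorphM.
Qed.

End dconv_theory.

Section unitary.
Context {R : realType}.
Local Notation mu := (@lebesgue_measure R).
Local Notation halfline := (@halfline R).
Local Notation C := (complex R).
Local Open Scope classical_set_scope.
Implicit Types (f g : R -> C) (a b : nat -> C).

Lemma ae_eq_trans f g h : Defs.ae_eq f g -> Defs.ae_eq g h -> Defs.ae_eq f h.
Proof.
by move=> fg gh; apply: ae_halflineS (ae_halflineI _ _ fg gh) => x _ [-> ->].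
Qed.

(** Makes the majorant an admissible argument of the L^2 bounds. Where it is infinite, [fine]
    returns 0 and the comparison is trivial. *)
Lemma L2_majorant a f : (weight a < +oo)%E -> L2 f ->
  L2 (fun x => Complex (fine (majorant a f x)) 0).
Proof.
move=> wa Lf; have /L2E[mf _] := Lf; apply/L2E.
have mh : cmeasurable (fun x => Complex (fine (majorant a f x)) 0).
  split => /=; last exact: measurable_cst.
  apply: (measurableT_comp (f := @fine R)); last exact: measurable_majorant.
  exact: fine_measurable.
split=> //; have /integrableP[mM] := integrable_majorant_sqr a f wa Lf.
apply: le_lt_trans; apply: ge0_le_integral.
- exact: measurable_halfline.
- by move=> x _; rewrite lee_fin exprn_ge0// normc_ge0.
- exact: measurable_normc2.
- by apply: measurableT_comp.
- move=> x _; rewrite normc_real gee0_abs ?mule_ge0 ?majorant_ge0//.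
  have := majorant_ge0 a f x; case: (majorant a f x) => [r| |]//= r0.
    by rewrite -EFinM lee_fin real_normK ?num_real// expr2.
  by rewrite normr0 expr0n mulyy leey.
Qed.

(** At almost every x, [csum_dconv] applies with v k = f(k x), and a * b = delta leaves the single
    term v 1 = f(x). *)
Lemma Top_inverse a b f : dconv_inverse a b ->
  (weight a < +oo)%E -> (weight b < +oo)%E -> L2 f ->
  Defs.ae_eq (Top a (Top b f)) f.
Proof.
move=> ab wa wb Lf.
(* Finiteness at every m x gives convergence of all inner series and ensures that [fine] is faithful
   there. *)
have maj_b : {ae mu, forall x, halfline x -> forall m, (majorant b f (m.+1%:R * x) < +oo)%E}.
  have : {ae mu, forall x, forall m, halfline x -> (majorant b f (m.+1%:R * x) < +oo)%E}.
    apply: ae_foralln => m.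
    exact: (ae_dilation _ _ (ltr0Sn R m) (ae_majorant_lty _ _ wb Lf)).
  move=> [N [mN N0 PN]]; exists N; split=> // x nT; apply: PN => /= hx.
  by apply: nT => xH m; exact: hx.
(* The majorant of [b] and [f] is square integrable, so that its own majorant for
   [a] is finite almost everywhere: this is the absolute convergence of the
   double series at almost every point. *)
have maj_a := ae_majorant_lty _ _ wa (L2_majorant _ _ wb Lf).
apply: ae_halflineS (ae_halflineI _ _ maj_a maj_b) => x _ [mx mbx].
pose v k := f (k%:R * x).
have row m n : f (n%:R * (m%:R * x)) = v (m * n)%N.
  by rewrite /v natrM mulrA [n%:R * _]mulrC.
transitivity (csum (fun m => a m * csum (fun n => b n * v (m * n)%N))).
  by apply: eq_csum => m _; congr (_ * _); apply: eq_csum => n _; rewrite row.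
rewrite csum_dconv.
- rewrite csum_single.
    by rewrite ab// eqxx mul1r /v mul1r.
  by move=> n n1; rewrite ab ?(ltnW n1)// gtn_eqF// mul0r.
(* Finiteness at x of the majorant of a majorant is the double summability, once [fine] is undone
   and |a_m| is moved inside the inner sum. *)
- move: mx; apply: le_lt_trans; apply: lee_nneseries => [m _ _|m _].
    by apply: nneseries_ge0 => n _ _; rewrite lee_fin.
  rewrite Normc.normcM normc_real.
  have fin : majorant b f (m.+1%:R * x) \is a fin_num.
    by rewrite ge0_fin_numE ?majorant_ge0.
  rewrite ger0_norm ?fine_ge0 ?majorant_ge0// EFinM fineK// /majorant -nneseriesZl; last first.
    by move=> n _; rewrite lee_fin normc_ge0.
  rewrite le_eqVlt; apply/orP; left; apply/eqP; apply: eq_eseriesr => n _.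
  by rewrite ger0_norm ?normc_ge0// -EFinM -Normc.normcM -row.
- move=> [//|m] _; apply/abs_csummableP.
  by have := mbx m; rewrite /majorant; under eq_eseriesr do rewrite row.
Qed.

Lemma Top_linear a (c : C) f g : (weight a < +oo)%E -> L2 f -> L2 g ->
  Defs.ae_eq (Top a (fun x => c * f x + g x)) (fun x => c * Top a f x + Top a g x).
Proof.
move=> wa Lf Lg.
have := ae_halflineI _ _ (ae_majorant_lty _ _ wa Lf) (ae_majorant_lty _ _ wa Lg).
apply: ae_halflineS => x _ [/majorant_abs_csummable cf /majorant_abs_csummable cg].
rewrite /Top -csumZ// -csumD//; last exact: abs_csummableZ.
by apply: eq_csum => n _; rewrite mulrDr mulrCA.
Qed.

Lemma weight_conj a : weight (fun n => conjc (a n)) = weight a.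
Proof. by rewrite /weight; apply: eq_eseriesr => n _; rewrite normc_conj. Qed.

Lemma unitary_Fop a b : dconv_inverse a b ->
  (weight a < +oo)%E -> (weight b < +oo)%E -> unitary_L2 (Fop a b).
Proof.
move=> ab wa wb; have ba := dconv_inverseC _ _ ab.
have ba' := dconv_inverse_conj _ _ ba.
have wa' : (weight (fun n => conjc (a n)) < +oo)%E by rewrite weight_conj.
have wb' : (weight (fun n => conjc (b n)) < +oo)%E by rewrite weight_conj.
have LT c f : (weight c < +oo)%E -> L2 f -> L2 (Top c f).
  by move=> wc /(Top_dominated _ _ wc)[].
have meas f : L2 f -> cmeasurable f by move=> /L2E[].
split.
- by move=> f Lf; apply: (LT) => //; apply: L2_Sop; exact: (LT).
- by move=> f g _ _ fg; apply: ae_Top; apply: ae_Sop; exact: ae_Top.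
- move=> c f g Lf Lg.
  have LSf := L2_Sop _ (LT _ _ wa Lf); have LSg := L2_Sop _ (LT _ _ wa Lg).
  apply: ae_eq_trans (Top_linear _ c _ _ wb' LSf LSg).
  apply: ae_Top; have := ae_Sop _ _ (Top_linear _ c _ _ wa Lf Lg).
  by apply: ae_halflineS => x _ ->; rewrite /Sop mulrDr mulrCA.
- move=> f Lf; rewrite /Fop L2sq_Top_Sop//; last exact: (LT).
  by apply: L2sq_ae (Top_inverse _ _ _ ba wb wa Lf); apply: meas => //; do 2 apply: (LT) => //.
- move=> g Lg; pose k := Top (fun n => conjc (a n)) g.
  have Lk : L2 k by exact: (LT).
  exists (Top b (Sop k)); first by apply: (LT) => //; exact: L2_Sop.
  (* What remains is S T(a) T(b) S k = k under T(conj b): T(a) cancels T(b) on S k, then S cancels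
     S. *)
  apply: ae_eq_trans (Top_inverse _ _ _ ba' wb' wa' Lg).
  apply: ae_Top; have := ae_Sop _ _ (Top_inverse _ _ _ ab wa wb (L2_Sop _ Lk)).
  by apply: ae_halflineS => x xH ->; rewrite SopK.
Qed.

End unitary.

Theorem theorem3 (R : realType) (a b : nat -> complex R) :
  a 1%N != 0 ->
  (exists2 eps : R, 0 < eps & wsummable (fun n => n%:R `^ eps) a) ->
  dconv_inverse a b ->
  wsummable (fun n => (Num.sqrt (n%:R : R))^-1) b ->
  unitary_L2 (Fop a b).
Proof.
(* For n >= 1, 1/sqrt n <= 1 = n^0 <= n^eps, so the hypothesis on a gives a finite weight. *)
move=> _ [eps eps0 wa] ab /weightE wb; apply: unitary_Fop => //; apply/weightE.
apply: le_lt_trans wa; apply: lee_nneseries => [n n1 _|n _].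
  by rewrite lee_fin mulr_ge0// ?normc_ge0// invr_ge0 sqrtr_ge0.
case: n => [|n].
  (* At index 0 the left-hand weight is the inverse of 0, which is 0 by convention. *)
  by rewrite lee_fin ler_wpM2l ?normc_ge0// sqrtr0 invr0 powR_ge0.
rewrite lee_fin ler_wpM2l ?normc_ge0// (@le_trans _ _ 1)//.
  rewrite invf_le1 ?sqrtr_gt0//.
  by rewrite -[X in X <= _]sqrtr1 ler_sqrt// ler1n.
by rewrite -[X in X <= _](powRr0 n.+1%:R) ler_powR ?ler1n// ltW.
Qed.
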